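(* Let $d\ge1$, $\Delta t>0$, and let $\{S_g\}$ be the particle shapes of a periodic mesh with finitely many mesh indices $g$. Let $\boldsymbol A_g^n,\boldsymbol A_g^{n+1},\boldsymbol U_g^n,\boldsymbol U_g^{n+1}\in\mathbb R^d$ be mesh values satisfying $$\boldsymbol A_g^{n+1}-\boldsymbol A_g^n=\Delta t\,\boldsymbol U_g^{n+1/2},\qquad \boldsymbol U_g^{n+1/2}=\tfrac12(\boldsymbol U_g^{n+1}+\boldsymbol U_g^n)\quad\text{for all } g.$$ Consider a particle $i$ with positions $\boldsymbol x_i^n,\boldsymbol x_i^{n+1}\in\mathbb R^d$ (unwrapped) and velocities $\boldsymbol v_i^n,\boldsymbol v_i^{n+1}\in\mathbb R^d$ such that $\boldsymbol x_i^{n+1}-\boldsymbol x_i^n=\Delta t\,\overline{\boldsymbol v}_i$ with $\overline{\boldsymbol v}_i=\tfrac12(\boldsymbol v_i^{n+1}+\boldsymbol v_i^n)$. For $0\le s\le1$ put $\boldsymbol x_i(s)=\boldsymbol x_i^n+s(\boldsymbol x_i^{n+1}-\boldsymbol x_i^n)$ and $\boldsymbol A_g(s)=(1-s)\boldsymbol A_g^n+s\boldsymbol A_g^{n+1}$, and define $$\overline S_{ig}=\int_0^1 S_g(\boldsymbol x_i(s))\,\mathrm ds,\qquad \overline{\boldsymbol U}_i=\sum_g\boldsymbol U_g^{n+1/2}\,\overline S_{ig},$$ and the $d\times d$ matrix $\mathsf D_i\boldsymbol A$ with entries $$[\mathsf D_i\boldsymbol A]_{\ell j}=\sum_g\int_0^1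 A_{\ell,g}(s)\,\partial_{x_j}S_g(\boldsymbol x_i(s))\,\mathrm ds,\qquad 1\le \ell,j\le d,$$ where $A_{\ell,g}(s)$ is the $\ell$-th component of $\boldsymbol A_g(s)$. With $\boldsymbol A_h^m(\boldsymbol x)=\sum_g\boldsymbol A_g^m S_g(\boldsymbol x)$ for $m\in\{n,n+1\}$, one has $$\boldsymbol A_h^{n+1}(\boldsymbol x_i^{n+1})-\boldsymbol A_h^n(\boldsymbol x_i^n)=\Delta t\,\overline{\boldsymbol U}_i+\Delta t\,(\mathsf D_i\boldsymbol A)\,\overline{\boldsymbol v}_i .$$
   Context: $S_g:\mathbb R^d\to\mathbb R$ is the periodic particle shape attached to mesh point $g$. It is either continuously differentiable, or a tensor product of one-dimensional continuous periodic piecewise-polynomial functions with finitely many knots per period (e.g. B-splines of degree at least $1$). In the latter case, at knots where the one-dimensional derivative does not exist, the derivative entering $\partial_{x_j}S_g$ is assigned one of its one-sided values by a fixed convention. All integrals are evaluated exactly. Particle displacements are unwrapped, and periodicity enters only through the periodicity of $S_g$. *)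

(* Defs.v *)
From HB Require Import structures.
From mathcomp Require Import all_boot all_order all_algebra.
From mathcomp Require Import all_classical all_reals all_analysis.
Set Implicit Arguments.
Unset Strict Implicit.
Unset Printing Implicit Defensive.
Import Order.TTheory GRing.Theory Num.Theory.
Import numFieldNormedType.Exports.
Local Open Scope classical_set_scope.
Local Open Scope ring_scope.

Section Shapes.
Context {R : realType}.

Definition basis_vec {d : nat} (j : 'I_d) : 'cV[R]_d := delta_mx j 0.

Definition C1 {d : nat} (S : 'cV[R]_d -> R) : Prop :=
  (forall x, differentiable S x) /\
  (forall j, continuous (fun x => 'D_(basis_vec j) S x)).

(* The knots in one period are the entries of [a :: s]; the values of [f] at
   the knots are governed by continuity. *)
Definition continuous_periodic_pw_poly (T : R) (f : R -> R) : Prop :=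
  [/\ continuous f, periodic f T &
      exists (a : R) (s : seq R), itv_partition a (a + T) s /\
        forall k, (k < size s)%N -> exists p : {poly R},
          {in `]nth a (a :: s) k, nth a s k[, forall x, f x = p.[x]}].

Definition is_right_derivative (f : R -> R) (x l : R) : Prop :=
  h^-1 * (f (x + h) - f x) @[h --> 0^'+] --> l.

Definition is_left_derivative (f : R -> R) (x l : R) : Prop :=
  h^-1 * (f (x + h) - f x) @[h --> 0^'-] --> l.

(* [df] is the derivative of [f] wherever it exists, and some choice of
   one-sided derivative elsewhere.  The choice may depend on the point, so that
   every convention (always left, always right, knot by knot) is covered. *)
Definition derivative_with_convention (f df : R -> R) : Prop :=
  forall x,
    (derivable f x 1 -> df x = 'D_1 f x) /\
    (~ derivable f x 1 ->
       is_left_derivative f x (df x) \/ is_right_derivative f x (df x)).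

(* [periodic_shape L S dS]: [S] is an admissible particle shape for the
   periodic box with side lengths [L j 0], and [dS j] is its [j]-th partial
   derivative, including the values assigned by convention at knots. *)
Definition periodic_shape {d : nat} (L : 'cV[R]_d)
    (S : 'cV[R]_d -> R) (dS : 'I_d -> 'cV[R]_d -> R) : Prop :=
  [/\ C1 S,
      (forall j, periodic S (L j 0 *: basis_vec j)) &
      (forall j x, dS j x = 'D_(basis_vec j) S x)]
  \/
  exists f df : 'I_d -> R -> R,
  [/\ (forall j, continuous_periodic_pw_poly (L j 0) (f j)),
      (forall j, derivative_with_convention (f j) (df j)),
      (forall x, S x = \prod_j f j (x j 0)) &
      (forall j x,
         dS j x = df j (x j 0) * \prod_(k | k != j) f k (x k 0))].

End Shapes.

Section Particle.
Context {R : realType} {d : nat} {G : finType}.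
Local Notation mu := (@lebesgue_measure R).

Definition average (u v : 'cV[R]_d) : 'cV[R]_d := 2^-1 *: (u + v).

Definition particle_path (x0 x1 : 'cV[R]_d) (s : R) : 'cV[R]_d :=
  x0 + s *: (x1 - x0).

Definition mesh_path (A0 A1 : G -> 'cV[R]_d) (s : R) (g : G) : 'cV[R]_d :=
  (1 - s) *: A0 g + s *: A1 g.

Definition mean_shape (S : G -> 'cV[R]_d -> R) (x0 x1 : 'cV[R]_d) (g : G) : R :=
  \int[mu]_(s in `[0, 1]) S g (particle_path x0 x1 s).

Definition mean_field (S : G -> 'cV[R]_d -> R) (U : G -> 'cV[R]_d)
    (x0 x1 : 'cV[R]_d) : 'cV[R]_d :=
  \sum_g mean_shape S x0 x1 g *: U g.

Definition mean_gradient (dS : G -> 'I_d -> 'cV[R]_d -> R)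
    (A0 A1 : G -> 'cV[R]_d) (x0 x1 : 'cV[R]_d) : 'M[R]_d :=
  \matrix_(l, j) \sum_g
    \int[mu]_(s in `[0, 1])
      (mesh_path A0 A1 s g l 0 * dS g j (particle_path x0 x1 s)).

Definition mesh_interp (S : G -> 'cV[R]_d -> R) (A : G -> 'cV[R]_d)
    (x : 'cV[R]_d) : 'cV[R]_d :=
  \sum_g S g x *: A g.

End Particle.

(* Main.v *)
Require Import Defs.
From HB Require Import structures.
From mathcomp Require Import all_boot all_order all_algebra.
From mathcomp Require Import all_classical all_reals all_analysis.
From mathcomp Require Import measurable_realfun ring lra.
Set Implicit Arguments.
Unset Strict Implicit.
Unset Printing Implicit Defensive.
Import Order.TTheory GRing.Theory Num.Theory.
Import numFieldNormedType.Exports.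
Local Open Scope classical_set_scope.
Local Open Scope ring_scope.

(** The identity is the fundamental theorem of calculus along the straight
path from [x0] to [x1].  For each mesh point [g] and component [l], put
[F s = A_{l,g}(s) * S_g(x(s))], with [A_{l,g}] and [x] affine in [s].  Where
the chain rule applies,
  [F' s = (A1_{l,g} - A0_{l,g}) * S_g(x(s))
          + A_{l,g}(s) * \sum_j (x1 - x0)_j * dS_{g,j}(x(s))],
so integrating over [[0, 1]], splitting the integral of the sum and summing
over [g] gives the claim, the increments of [A] and of [x] being [dt] times
the averages ([affine_shape_balance]).

For a C1 shape this is classical.  For a tensor product of piecewise
polynomials the path may meet knots, even stay on one for all [s] in the
coordinates [j] where [(x1 - x0)_j = 0].  Both difficulties disappear with a
local, one-sided notion: [pw_C1 F f] says that [F] is continuous and that on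
each side of each point the pair [(F, f)] coincides with some C1 function and
its derivative.  The value of [f] at the point itself is irrelevant, hence so
is the convention at knots.  This relation satisfies the product rule
([pw_C1M], [pw_C1_prod]) and is stable under composition with any affine map,
constant maps included ([pw_C1_affine]: a coordinate at rest gives a constant
function, with derivative [0 * f]).  It holds for a periodic piecewise
polynomial and its derivative by convention ([periodic_pw_poly_pw_C1]).
Finally [pw_C1 F f] implies that [f] is integrable and that its integral is
the increment of [F] ([pw_C1_FTC]): both statements are additive over adjacent
intervals and true on small intervals on each side of each point, hence true
on every segment ([additive_interval_ind]). *)

(** * One-sided neighbourhoods of a real number *)

Section Sides.
Context {R : realType}.
Implicit Types (a b c t u v w x y z : R) (f g F G : R -> R).

(** The filter of right ([r = true]) or left ([r = false]) punctured
neighbourhoods of [t]; the Boolean makes it possible to treat both sides at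
once. *)
Definition side (r : bool) (t : R) : set_system R := if r then t^'+ else t^'-.

Global Instance side_filter r t : ProperFilter (side r t).
Proof. by case: r; rewrite /side; exact: _. Qed.

Lemma cvg_side r t f : continuous f -> f z @[z --> side r t] --> f t.
Proof.
by move=> cf; case: r; [apply: cvg_at_right_filter|apply: cvg_at_left_filter];
  exact: cf.
Qed.

Lemma continuous_eq_side r t f g : continuous f -> continuous g ->
  (\forall z \near side r t, f z = g z) -> f t = g t.
Proof.
move=> cf cg fg; have ft := @cvg_side r t _ cf.
have gt : f z @[z --> side r t] --> g t.
  apply: cvg_trans (@cvg_side r t _ cg); apply: near_eq_cvg.
  by apply: filterS fg => z ->.
exact: (cvg_unique _ ft gt).
Qed.

Lemma near_right_itv t (P : set R) : (\forall z \near t^'+, P z) ->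
  \forall v \near t^'+, forall z, t < z < v -> P z.
Proof.
rewrite {1}/at_right near_withinE => /nbhs_ballP[e /= e0 eP].
near=> v => z /andP[tz zv]; apply: eP => //.
rewrite /ball/= distrC ger0_norm; last by rewrite subr_ge0 ltW.
rewrite ltrBlDl (lt_trans zv)//; near: v; apply: nbhs_right_lt.
by rewrite ltrDl.
Unshelve. all: by end_near. Qed.

Lemma near_left_itv t (P : set R) : (\forall z \near t^'-, P z) ->
  \forall u \near t^'-, forall z, u < z < t -> P z.
Proof.
rewrite {1}/at_left near_withinE => /nbhs_ballP[e /= e0 eP].
near=> u => z /andP[uz zt]; apply: eP => //.
rewrite /ball/= ger0_norm; last by rewrite subr_ge0 ltW.
rewrite ltrBlDl -ltrBlDr (le_lt_trans _ uz)//; near: u; apply: nbhs_left_ge.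
by rewrite ltrBlDr ltrDl.
Unshelve. all: by end_near. Qed.

Lemma near_side_near r t (P : set R) : (\forall z \near side r t, P z) ->
  \forall z \near side r t, \forall y \near z, P y.
Proof.
case: r; rewrite /side.
  move=> /near_right_itv tP; near (t^'+) => v.
  have tvP : forall z, t < z < v -> P z by near: v.
  near=> z.
  have : z \in `]t, v[.
    rewrite in_itv/=; apply/andP; split; near: z.
      exact: nbhs_right_gt.
    by apply: nbhs_right_lt; near: v; exact: nbhs_right_gt.
  move=> /near_in_itvoo; apply: filterS => y; rewrite in_itv/=; exact: tvP.
move=> /near_left_itv tP; near (t^'-) => u.
have utP : forall z, u < z < t -> P z by near: u.
near=> z.
have : z \in `]u, t[.
  rewrite in_itv/=; apply/andP; split; near: z.
    by apply: nbhs_left_gt; near: u; exact: nbhs_left_lt.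
  exact: nbhs_left_lt.
move=> /near_in_itvoo; apply: filterS => y; rewrite in_itv/=; exact: utP.
Unshelve. all: by end_near. Qed.

(** A nonconstant affine map keeps or exchanges the two sides of a point,
according to the sign of its slope. *)
Lemma cvg_side_affine r t x w : w != 0 ->
  (fun s : R => x + s * w) @ side r t --> side (r == (0 < w)) (x + t * w).
Proof.
move=> w0.
have cw : continuous (fun s : R => x + s * w).
  by move=> s; apply: cvgD; [exact: cvg_cst|apply: cvgM => //; exact: cvg_cst].
have [wp|wn|w00] := ltgtP w 0; last by rewrite w00 eqxx in w0.
- case: r; rewrite /side/= => A tA; have {tA}:= cw t _ tA.
    change (nbhs t (fun z => x + z * w < x + t * w -> A (x + z * w)) ->
      nbhs t (fun z => t < z -> A (x + z * w))).
    by apply: filterS => z Az tz; apply: Az; rewrite ltrD2l ltr_nM2r.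
  change (nbhs t (fun z => x + t * w < x + z * w -> A (x + z * w)) ->
    nbhs t (fun z => z < t -> A (x + z * w))).
  by apply: filterS => z Az tz; apply: Az; rewrite ltrD2l ltr_nM2r.
- case: r; rewrite /side/= => A tA; have {tA}:= cw t _ tA.
    change (nbhs t (fun z => x + t * w < x + z * w -> A (x + z * w)) ->
      nbhs t (fun z => t < z -> A (x + z * w))).
    by apply: filterS => z Az tz; apply: Az; rewrite ltrD2l ltr_pM2r.
  change (nbhs t (fun z => x + z * w < x + t * w -> A (x + z * w)) ->
    nbhs t (fun z => z < t -> A (x + z * w))).
  by apply: filterS => z Az tz; apply: Az; rewrite ltrD2l ltr_pM2r.
Qed.

(** Local-to-global principle on segments: the supremum of the [t] with
[P a t] satisfies this property, and it cannot be smaller than [b]. *)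
Lemma additive_interval_ind (P : R -> R -> Prop) :
  (forall u, P u u) ->
  (forall u v w, u <= v -> v <= w -> P u v -> P v w -> P u w) ->
  (forall t, \forall u \near t^'-, P u t) ->
  (forall t, \forall v \near t^'+, P t v) ->
  forall a b, a <= b -> P a b.
Proof.
move=> Pxx Ptrans Pl Pr a b ab.
pose E := [set t | a <= t <= b /\ P a t].
have Ea : E a by split; [rewrite lexx|exact: Pxx].
have supE : has_sup E.
  by split; [exists a|exists b => t [/andP[]]].
have ac : a <= sup E by apply: ub_le_sup => //; exact: (proj2 supE).
have cb : sup E <= b by apply: ge_sup; [exists a|move=> t [/andP[]]].
(* the supremum is attained, by the local property on its left *)
have Pac : P a (sup E).
  have /near_left_itv := Pl (sup E); move=> near_c.
  near ((sup E)^'-) => u.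
  have uc : u < sup E by near: u; exact: nbhs_left_lt.
  have Pu : forall z, u < z < sup E -> P z (sup E) by near: u.
  have e0 : 0 < sup E - u by rewrite subr_gt0.
  have [t [/andP[at_ tb] Pat]] := sup_adherent e0 supE.
  rewrite subKr => ut.
  have tc : t <= sup E.
    by apply: ub_le_sup => //; [exact: (proj2 supE)|split=> //; rewrite at_].
  move: tc; rewrite le_eqVlt => /predU1P[<-//|tc].
  by apply: (Ptrans _ _ _ at_ (ltW tc) Pat); apply: Pu; rewrite ut.
move: cb; rewrite le_eqVlt => /predU1P[<-//|cb].
(* it cannot be smaller than [b], by the local property on its right *)
near ((sup E)^'+) => v.
have cv : sup E < v by near: v; exact: nbhs_right_gt.
have vb : v <= b by near: v; exact: nbhs_right_le.
have : v <= sup E.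
  apply: ub_le_sup; first exact: (proj2 supE).
  split; first by rewrite vb andbT (le_trans ac)// ltW.
  apply: (Ptrans _ _ _ ac (ltW cv) Pac).
  by near: v; exact: Pr.
by rewrite leNgt cv.
Unshelve. all: by end_near. Qed.

End Sides.

(** * Piecewise continuous and piecewise C1 functions *)

Section PiecewiseContinuous.
Context {R : realType}.
Implicit Types (a b c t u v w x y z : R) (f g F G P p : R -> R).
Local Notation mu := (@lebesgue_measure R).

(** On each side of each point, [f] coincides with a continuous function.  The
value at the point is not constrained; on a segment, [f] has finitely many
discontinuities, at each of which it has one-sided limits. *)
Definition pw_continuous (f : R -> R) : Prop := forall r t,
  exists2 p : R -> R, continuous p & \forall z \near side r t, f z = p z.

Lemma continuous_pw_continuous f : continuous f -> pw_continuous f.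
Proof. by move=> cf r t; exists f => //; near=> z.
Unshelve. all: by end_near. Qed.

Lemma pw_continuousM f g : pw_continuous f -> pw_continuous g ->
  pw_continuous (f \* g).
Proof.
move=> pf pg r t; have [p cp fp] := pf r t; have [q cq gq] := pg r t.
exists (p \* q) => [z|]; first by apply: cvgM; [exact: cp|exact: cq].
by near=> z => /=; rewrite (near fp)// (near gq).
Unshelve. all: by end_near. Qed.

Lemma pw_continuous_affine f x w : pw_continuous f ->
  pw_continuous (fun s => f (x + s * w)).
Proof.
move=> pf; have [->|w0] := eqVneq w 0.
  apply: continuous_pw_continuous => s; under eq_fun do rewrite mulr0 addr0.
  exact: cvg_cst.
move=> r t; have [p cp fp] := pf (r == (0 < w)) (x + t * w).
exists (fun s => p (x + s * w)); last exact: (cvg_side_affine w0 fp).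
move=> s; apply: continuous_comp; last exact: cp.
by apply: cvgD; [exact: cvg_cst|apply: cvgM => //; exact: cvg_cst].
Qed.

(** The endpoints have measure zero. *)
Lemma integrable_ooW u v f : mu.-integrable `]u, v[ (EFin \o f) ->
  mu.-integrable `[u, v] (EFin \o f).
Proof.
move=> /integrableP[mf fi]; apply/integrableP; split.
  by apply/emeasurable_fun_itv_obnd_cbndP/emeasurable_fun_itv_bndo_bndcP.
by rewrite integral_itv_bndoo//; exact: measurableT_comp.
Qed.

Lemma eq_integrable_oo u v f p : continuous p ->
  (forall z, u < z < v -> f z = p z) -> mu.-integrable `[u, v] (EFin \o f).
Proof.
move=> cp fp; apply: integrable_ooW.
apply: (@eq_integrable _ _ _ mu _ _ (EFin \o p)) => //.
  by move=> z; rewrite inE/= in_itv/= => /fp ->.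
apply: (@integrableS _ _ _ mu `[u, v]) => //.
  by apply: subset_itv_oo_cc.
apply: continuous_compact_integrable; first exact: segment_compact.
exact: continuous_subspaceT.
Qed.

Lemma integrable_itv_cat u v w f : u <= v -> v <= w ->
  mu.-integrable `[u, v] (EFin \o f) -> mu.-integrable `[v, w] (EFin \o f) ->
  mu.-integrable `[u, w] (EFin \o f).
Proof.
move=> uv vw iuv ivw.
have {}iuv : mu.-integrable `[u, v[ (EFin \o f).
  by apply: integrableS iuv => //; apply: subset_itvl; rewrite bnd_simp.
rewrite (@itv_bndbnd_setU _ _ _ (BLeft v))//.
move/integrableP: iuv => [muv fuv]; move/integrableP: ivw => [mvw fvw].
apply/integrableP; split; first exact/measurable_funU.
rewrite ge0_integral_setU//.
- by rewrite lte_add_pinfty.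
- by apply/measurableT_comp => //; exact/measurable_funU.
- apply/disj_setPS => y [/=]; rewrite 2!in_itv/= => /andP[_ yx] /andP[].
  by rewrite leNgt yx.
Qed.

Lemma pw_continuous_integrable f a b : a <= b -> pw_continuous f ->
  mu.-integrable `[a, b] (EFin \o f).
Proof.
move=> ab pf; move: a b ab; apply: additive_interval_ind.
- move=> u; apply: (@eq_integrable_oo _ _ _ (cst 0)).
    exact: cst_continuous.
  by move=> z /andP[uz zu]; have := lt_trans uz zu; rewrite ltxx.
- by move=> u v w; exact: integrable_itv_cat.
- move=> t; have [p cp /near_left_itv] := pf false t.
  by apply: filterS => u fp; exact: eq_integrable_oo cp fp.
- move=> t; have [p cp /near_right_itv] := pf true t.
  by apply: filterS => u fp; exact: eq_integrable_oo cp fp.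
Qed.

(** [F] is continuous and, on each side of each point, [(F, f)] coincides with
a C1 function and its derivative.  No relation is required between [f t] and
[F] at the point [t] itself. *)
Definition pw_C1 (F f : R -> R) : Prop := continuous F /\ forall r t,
  exists P p : R -> R, [/\ forall z : R, is_derive z (1 : R) P (p z),
    continuous p & \forall z \near side r t, F z = P z /\ f z = p z].

Lemma is_derive_continuous P p : (forall z : R, is_derive z (1 : R) P (p z)) ->
  continuous P.
Proof.
move=> Pp z; have [dP _] := Pp z; apply/differentiable_continuous.
exact/derivable1_diffP.
Qed.

Lemma pw_C1_continuous F f : pw_C1 F f -> pw_continuous f.
Proof.
by move=> [_ Ff] r t; have [P [p [_ cp fp]]] := Ff r t; exists p => //;
  apply: filterS fp => z [].
Qed.

Lemma C1_pw_C1 F f : (forall z : R, is_derive z (1 : R) F (f z)) ->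
  continuous f -> pw_C1 F f.
Proof.
move=> Ff cf; split; first exact: is_derive_continuous Ff.
by move=> r t; exists F, f; split => //; near=> z.
Unshelve. all: by end_near. Qed.

Lemma pw_C1_cst c : pw_C1 (cst c) (cst 0).
Proof.
by apply: C1_pw_C1; exact: cst_continuous.
Qed.

Lemma pw_C1M F f G g : pw_C1 F f -> pw_C1 G g ->
  pw_C1 (F \* G) (fun s => f s * G s + F s * g s).
Proof.
move=> [cF Ff] [cG Gg]; split.
  by move=> z; apply: cvgM; [exact: cF|exact: cG].
move=> r t; have [P [p [Pp cp FP]]] := Ff r t.
have [Q [q [Qq cq GQ]]] := Gg r t.
exists (P * Q), (fun s => p s * Q s + P s * q s); split.
- move=> z; apply: is_derive_eq; rewrite addrC; congr (_ + _).
  by rewrite mulrC.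
- have cP := is_derive_continuous Pp; have cQ := is_derive_continuous Qq.
  move=> z; apply: cvgD; apply: cvgM.
  + exact: cp.
  + exact: cQ.
  + exact: cP.
  + exact: cq.
- by apply: filterS2 FP GQ => z /= [-> ->] [-> ->].
Qed.

Lemma pw_C1_prod (I : eqType) (r : seq I) (F f : I -> R -> R) : uniq r ->
  (forall i, pw_C1 (F i) (f i)) ->
  pw_C1 (fun s => \prod_(i <- r) F i s)
    (fun s => \sum_(i <- r) f i s * \prod_(k <- r | k != i) F k s).
Proof.
move=> + Ff; elim: r => [_|i r ih /= /andP[ir ur]].
  under [X in pw_C1 X _]eq_fun do rewrite big_nil.
  under [X in pw_C1 _ X]eq_fun do rewrite big_nil.
  exact: pw_C1_cst.
have := pw_C1M (Ff i) (ih ur); congr pw_C1; apply/funext => s /=.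
  by rewrite big_cons.
rewrite big_cons; congr (_ + _).
  rewrite big_cons eqxx/=; congr (_ * _).
  rewrite [LHS]big_seq [RHS]big_seq_cond; apply: eq_bigl => k.
  by have [kr|//] := boolP (k \in r); rewrite (memPn ir).
rewrite mulr_sumr; apply: eq_big_seq => k kr.
rewrite big_cons eq_sym (memPn ir)//=; ring.
Qed.

(** The slope [w] may vanish: then both functions are constant, whatever the
behaviour of [F] at [x]. *)
Lemma pw_C1_affine F f x w : pw_C1 F f ->
  pw_C1 (fun s => F (x + s * w)) (fun s => w * f (x + s * w)).
Proof.
move=> [cF Ff]; have [->|w0] := eqVneq w 0.
  under [X in pw_C1 X _]eq_fun do rewrite mulr0 addr0.
  under [X in pw_C1 _ X]eq_fun do rewrite mul0r.
  exact: pw_C1_cst.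
have dw z : is_derive (z : R) (1 : R) (fun s : R => x + s * w) w.
  have -> : (fun s : R => x + s * w) = horner (x%:P + w *: 'X).
    by apply/funext => s; rewrite !hornerE mulrC.
  apply: (trigger_derive (@is_derive_poly _ _ _)).
  by rewrite derivD derivC derivZ derivX !hornerE.
have cw := is_derive_continuous dw.
split; first by move=> s; exact: (continuous_comp (cw s) (cF _)).
move=> r t; have [P [p [Pp cp FP]]] := Ff (r == (0 < w)) (x + t * w).
exists (fun s => P (x + s * w)), (fun s => w * p (x + s * w)); split.
- move=> z; rewrite mulrC.
  exact: (@is_derive1_comp _ P (fun s : R => x + s * w) z _ _ (Pp _) (dw z)).
- move=> s; apply: cvgM; first exact: cvg_cst.
  exact: (continuous_comp (cw s) (cp _)).
- have : \forall s \near side r t,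
      F (x + s * w) = P (x + s * w) /\ f (x + s * w) = p (x + s * w).
    exact: (cvg_side_affine w0 FP).
  by apply: filterS => s /= [-> ->].
Qed.

Lemma Rintegral_cat u v w f : u <= v -> v <= w ->
  mu.-integrable `[u, w] (EFin \o f) ->
  \int[mu]_(s in `[u, w]) f s =
  \int[mu]_(s in `[u, v]) f s + \int[mu]_(s in `[v, w]) f s.
Proof.
move=> uv vw fi; apply/eqP; rewrite addrC -subr_eq.
rewrite Rintegral_itvB//; first rewrite Rintegral_itv_obnd_cbnd//.
by apply: integrableS fi => //; apply: subset_itvr; rewrite bnd_simp.
Qed.

(** Fundamental theorem of calculus on a segment on whose interior [(F, f)] is
the restriction of a C1 function and its derivative; [F] and [P] agree at the
endpoints by continuity. *)
Lemma eq_FTC_oo u v F f P p : u < v -> continuous F ->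
  (forall z : R, is_derive z (1 : R) P (p z)) -> continuous p ->
  (forall z, u < z < v -> F z = P z /\ f z = p z) ->
  \int[mu]_(s in `[u, v]) f s = F v - F u.
Proof.
move=> uv cF Pp cp FP; have cP := is_derive_continuous Pp.
have -> : F u = P u.
  apply: (continuous_eq_side (r := true)) => //; near=> z.
  apply: (FP _ _).1; apply/andP; split.
    by near: z; exact: nbhs_right_gt.
  by near: z; exact: nbhs_right_lt.
have -> : F v = P v.
  apply: (continuous_eq_side (r := false)) => //; near=> z.
  apply: (FP _ _).1; apply/andP; split.
    by near: z; exact: nbhs_left_gt.
  by near: z; exact: nbhs_left_lt.
have ip : mu.-integrable `[u, v] (EFin \o p) by exact: (eq_integrable_oo cp).
have mf g : mu.-integrable `[u, v] (EFin \o g) ->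
    measurable_fun `]u, v[ (EFin \o g).
  move=> gi; apply: (measurable_int mu); apply: integrableS gi => //.
  exact: subset_itv_oo_cc.
transitivity (\int[mu]_(s in `[u, v]) p s).
  rewrite /Rintegral integral_itv_bndoo//; last first.
    exact: (mf f (eq_integrable_oo cp (fun z uzv => (FP z uzv).2))).
  rewrite [in RHS]integral_itv_bndoo//; last exact: (mf p ip).
  by congr fine; apply: eq_integral => z; rewrite inE/= in_itv/= => /FP[_ ->].
rewrite /Rintegral (@continuous_FTC2 _ p P)//.
- exact: continuous_subspaceT.
- split; first by move=> z _; case: (Pp z).
    exact: (cvg_side true).
  exact: (cvg_side false).
- by move=> z _; rewrite derive1E; exact: derive_val.
Unshelve. all: by end_near. Qed.

Lemma pw_C1_FTC F f a b : a <= b -> pw_C1 F f ->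
  \int[mu]_(s in `[a, b]) f s = F b - F a.
Proof.
move=> ab Ff; have fi u v (uv : u <= v) :=
  pw_continuous_integrable uv (pw_C1_continuous Ff).
case: Ff => cF Ff; move: a b ab; apply: additive_interval_ind.
- by move=> u; rewrite set_itv1 Rintegral_set1 subrr.
- move=> u v w uv vw; rewrite (Rintegral_cat uv vw)//.
    by move=> -> ->; rewrite addrC subrKA.
  by apply: fi; exact: le_trans vw.
- move=> t; have [P [p [Pp cp /near_left_itv FP]]] := Ff false t.
  near=> u; apply: (@eq_FTC_oo u t F f P p) => //.
  by near: u.
- move=> t; have [P [p [Pp cp /near_right_itv FP]]] := Ff true t.
  near=> u; apply: (@eq_FTC_oo t u F f P p) => //.
  by near: u.
Unshelve. all: by end_near. Qed.

End PiecewiseContinuous.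

(** * Periodic piecewise polynomials *)

Section PeriodicPiecewisePolynomials.
Context {R : realType}.
Implicit Types (a b c t u v w x y z T : R) (f df : R -> R).

Lemma itv_partition_right a b (s : seq R) y : itv_partition a b s ->
  a <= y < b ->
  exists2 k, (k < size s)%N & nth a (a :: s) k <= y < nth a s k.
Proof.
rewrite /itv_partition; elim: s a => [a [_ /= /eqP <-]|c s ih a].
  by move=> /andP[ay ya]; have := le_lt_trans ay ya; rewrite ltxx.
move=> /= [/andP[ac pcs] lcs] /andP[ay yb]; have [yc|cy] := ltP y c.
  by exists 0%N => //=; rewrite ay.
have [|k ks] := ih c (conj pcs lcs); first by rewrite cy.
exists k.+1 => //=; rewrite (set_nth_default c a ks).
by rewrite (@set_nth_default _ (c :: s) c a)//= ltnS ltnW.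
Qed.

Lemma itv_partition_left a b (s : seq R) y : itv_partition a b s ->
  a < y <= b ->
  exists2 k, (k < size s)%N & nth a (a :: s) k < y <= nth a s k.
Proof.
rewrite /itv_partition; elim: s a => [a [_ /= /eqP <-]|c s ih a].
  by move=> /andP[ay ya]; have := lt_le_trans ay ya; rewrite ltxx.
move=> /= [/andP[ac pcs] lcs] /andP[ay yb]; have [yc|cy] := leP y c.
  by exists 0%N => //=; rewrite ay.
have [|k ks] := ih c (conj pcs lcs); first by rewrite cy.
exists k.+1 => //=; rewrite (set_nth_default c a ks).
by rewrite (@set_nth_default _ (c :: s) c a)//= ltnS ltnW.
Qed.

(** Each side of each point [t] of the partitioned segment lies in one open
cell of the partition.  For [r = true] the right endpoint [b] has to be
excluded, for [r = false] the left endpoint [a]. *)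
Lemma itv_partition_side r t a b (s : seq R) : itv_partition a b s ->
  (if r then a <= t < b else a < t <= b) ->
  exists2 k, (k < size s)%N &
    \forall z \near side r t, z \in `]nth a (a :: s) k, nth a s k[.
Proof.
case: r => abs atb.
  have [k ks /andP[kt tk]] := itv_partition_right abs atb; exists k => //.
  near=> z; rewrite in_itv/=; apply/andP; split.
    by apply: le_lt_trans kt _; near: z; exact: nbhs_right_gt.
  by near: z; exact: nbhs_right_lt.
have [k ks /andP[kt tk]] := itv_partition_left abs atb; exists k => //.
near=> z; rewrite in_itv/=; apply/andP; split.
  by near: z; exact: nbhs_left_gt.
by apply: lt_le_trans _ tk; near: z; exact: nbhs_left_lt.
Unshelve. all: by end_near. Qed.

Lemma periodic_int f T (n : int) x : periodic f T -> f (x + n%:~R * T) = f x.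
Proof.
move=> fT; rewrite mulrzl; case: n => n; first exact: (periodicn fT).
by rewrite NegzE mulrNz -[in RHS](subrK (T *+ n.+1) x) (periodicn fT).
Qed.

(** The period containing the translate of [t] is half-open, on the side which
lets the one-sided neighbourhoods of the translate stay inside it. *)
Lemma translate_period r T a t : 0 < T -> exists n : int,
  if r then a <= t + n%:~R * T < a + T else a < t + n%:~R * T <= a + T.
Proof.
move=> T0; have Tn0 : T != 0 by rewrite gt_eqF.
have tE : t - a = (t - a) / T * T by rewrite divfK.
case: r.
  exists (- Num.floor ((t - a) / T)).
  have /andP[] := floor_itv ((t - a) / T).
  rewrite -(ler_pM2r T0) -(ltr_pM2r T0) -tE intrD mulrDl mulrNz; lra.
exists (- (Num.ceil ((t - a) / T) - 1)).
have /andP[] := ceil_itv ((t - a) / T).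
rewrite -(ler_pM2r T0) -(ltr_pM2r T0) -tE !mulrNz !intrD !mulrDl mulrNz; lra.
Qed.

Lemma periodic_pw_poly_germ T f r t : 0 < T ->
  continuous_periodic_pw_poly T f ->
  exists p : {poly R}, \forall z \near side r t, f z = p.[z].
Proof.
move=> T0 [_ fT [a [s [aTs fs]]]].
have [n tn] := translate_period r a t T0.
have [k ks nk] := itv_partition_side aTs tn.
have [p fp] := fs k ks; exists (p \Po ('X + (n%:~R * T)%:P)).
have := @cvg_side_affine _ r t (n%:~R * T) 1 (oner_neq0 _).
rewrite ltr01 eqb_id mulr1 [_ * T + t]addrC => /(_ _ nk) {}nk.
have {}nk : \forall z \near side r t,
    n%:~R * T + z * 1 \in `]nth a (a :: s) k, nth a s k[ by exact: nk.
apply: filterS nk => z; rewrite mulr1 addrC => znk.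
by rewrite horner_comp !hornerE -fp// periodic_int.
Qed.

(** Near a knot, but away from it, the function is a polynomial on a full
neighbourhood of each point, so the derivative given by the convention is the
genuine one there. *)
Lemma periodic_pw_poly_pw_C1 T f df : 0 < T ->
  continuous_periodic_pw_poly T f -> derivative_with_convention f df ->
  pw_C1 f df.
Proof.
move=> T0 fpp fdf; split; first by case: fpp.
move=> r t; have [p fp] := periodic_pw_poly_germ r t T0 fpp.
exists (horner p), (horner p^`()); split.
- by move=> z; exact: is_derive_poly.
- exact: continuous_horner.
have := near_side_near fp; apply: filterS => z fpz.
split; first exact: nbhs_singleton fpz.
have [dz _] := fdf z.
have pfz : \near z, (horner p) z = f z by apply: filterS fpz => y ->.
have [dp dpE] := is_derive_poly p z.
rewrite dz; first by rewrite -dpE; exact: near_eq_derive.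
exact: near_eq_derivable pfz dp.
Qed.

End PeriodicPiecewisePolynomials.

(** * Shapes along a line *)

Section Path.
Context {R : realType} {d : nat}.
Implicit Types (S : 'cV[R]_d -> R) (x w L : 'cV[R]_d).

Lemma basis_vec_sum w : w = \sum_j w j 0 *: basis_vec j.
Proof.
apply/colP => i; rewrite summxE (bigD1 i)//= big1 => [|j ji].
  by rewrite !mxE !eqxx mulr1 addr0.
by rewrite !mxE eq_sym (negbTE ji) mulr0.
Qed.

Lemma derive_sum_basis S x w : differentiable S x ->
  'D_w S x = \sum_j w j 0 * 'D_(basis_vec j) S x.
Proof.
move=> dS; rewrite deriveE// {1}(basis_vec_sum w) linear_sum.
by apply: eq_bigr => j _; rewrite linearZ deriveE.
Qed.

(** The difference quotients of [S] along the line are those of [S] in the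
direction [w]. *)
Lemma is_derive_line S x w (s : R) : differentiable S (x + s *: w) ->
  is_derive s (1 : R) (fun s => S (x + s *: w)) ('D_w S (x + s *: w)).
Proof.
move=> dS.
have quotE : (fun h : R => h^-1 *:
      ((fun s => S (x + s *: w)) (h *: (1 : R) + s) - S (x + s *: w))) =
    (fun h : R => h^-1 *: (S (h *: w + (x + s *: w)) - S (x + s *: w))).
  apply/funext => h; congr (_ *: (S _ - _)).
  by rewrite scaler1 scalerDl addrCA.
have := @diff_derivable _ _ _ S _ w dS.
rewrite /derivable -quotE => dSw; split => //.
by rewrite /derive quotE.
Qed.

Lemma continuous_line x w : continuous (fun s : R => x + s *: w).
Proof.
move=> s; apply: cvgD; first exact: cvg_cst.
exact: scalel_continuous.
Qed.

(** Chain rule for an admissible shape along a line, in the piecewise sense,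
together with the piecewise continuity of each partial derivative separately.
The latter is needed because the mean gradient integrates the partial
derivatives one at a time. *)
Lemma periodic_shape_line L S (dS : 'I_d -> 'cV[R]_d -> R) x w :
  (forall j, 0 < L j 0) -> periodic_shape L S dS ->
  pw_C1 (fun s : R => S (x + s *: w))
    (fun s => \sum_j w j 0 * dS j (x + s *: w)) /\
  forall j, pw_continuous (fun s : R => dS j (x + s *: w)).
Proof.
move=> L0 [[[S1 cS] _ dSE]|[f [df [fpp fdf SE dSE]]]].
  have cdS j : continuous (fun s : R => dS j (x + s *: w)).
    have -> : (fun s : R => dS j (x + s *: w)) =
        (fun y => 'D_(basis_vec j) S y) \o (fun s : R => x + s *: w).
      by apply/funext => s /=; exact: dSE.
    by move=> s; apply: continuous_comp; [exact: continuous_line|exact: cS].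
  split; last by move=> j; exact: continuous_pw_continuous.
  apply: C1_pw_C1.
    move=> s; apply: trigger_derive (is_derive_line _) _ => //.
    by rewrite derive_sum_basis//; apply: eq_bigr => j _; rewrite dSE.
  move=> s; apply: cvg_big => [|j _]; first exact: add_continuous.
  by apply: cvgM; [exact: cvg_cst|exact: cdS].
have fC1 j := periodic_pw_poly_pw_C1 (L0 j) (fpp j) (fdf j).
have lE j (s : R) : (x + s *: w) j 0 = x j 0 + s * w j 0 by rewrite !mxE.
split.
  have := pw_C1_prod (index_enum_uniq 'I_d)
    (fun j => pw_C1_affine (x j 0) (w j 0) (fC1 j)).
  congr pw_C1; apply/funext => s; rewrite ?SE.
    by apply: eq_bigr => j _; rewrite lE.
  apply: eq_bigr => j _; rewrite dSE lE mulrA; congr (_ * _).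
  by apply: eq_bigr => k _; rewrite lE.
move=> j.
have -> : (fun s : R => dS j (x + s *: w)) =
    (fun s => df j (x j 0 + s * w j 0)) \*
    (fun s => \prod_(k <- [seq k <- index_enum 'I_d | k != j])
      f k (x k 0 + s * w k 0)).
  apply/funext => s /=; rewrite dSE lE big_filter; congr (_ * _).
  by apply: eq_bigr => k _; rewrite lE.
apply: pw_continuousM.
  exact: (pw_continuous_affine (x j 0) (w j 0) (pw_C1_continuous (fC1 j))).
apply: continuous_pw_continuous; apply: (proj1 (pw_C1_prod _ _)).
  exact/filter_uniq/index_enum_uniq.
by move=> k; exact: pw_C1_affine (fC1 k).
Qed.

End Path.

(** * Balance along a line *)

Section Balance.
Context {R : realType}.
Local Notation mu := (@lebesgue_measure R).

Lemma integrable_lin_comb a b (I : Type) (r : seq I) (c : I -> R)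
    (f : I -> R -> R) :
  (forall i, mu.-integrable `[a, b] (EFin \o f i)) ->
  mu.-integrable `[a, b] (EFin \o (fun s => \sum_(i <- r) c i * f i s)).
Proof.
move=> fi.
rewrite (_ : EFin \o _ = fun s => (\sum_(i <- r) (c i * f i s)%:E)%E).
  by apply: integrable_sum => // i _; exact: (integrableZl _ (c i) (fi i)).
by apply/funext => s /=; rewrite sumEFin.
Qed.

Lemma Rintegral_lin_comb a b (I : Type) (r : seq I) (c : I -> R)
    (f : I -> R -> R) :
  (forall i, mu.-integrable `[a, b] (EFin \o f i)) ->
  \int[mu]_(s in `[a, b]) (\sum_(i <- r) c i * f i s) =
  \sum_(i <- r) c i * \int[mu]_(s in `[a, b]) f i s.
Proof.
move=> fi; elim: r => [|i r ih].
  rewrite big_nil; under eq_Rintegral do rewrite big_nil.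
  by rewrite Rintegral_cst// mul0r.
rewrite big_cons -ih -RintegralZl// -RintegralD//.
- by apply: eq_Rintegral => s _; rewrite big_cons.
- exact: (integrableZl _ (c i) (fi i)).
- exact: integrable_lin_comb.
Qed.

(** The statement for one mesh point and one component of the field, on the
path from [x] to [x + w]. *)
Lemma affine_shape_balance (d : nat) (L x w : 'cV[R]_d) (S : 'cV[R]_d -> R)
    (dS : 'I_d -> 'cV[R]_d -> R) (a0 a1 : R) :
  (forall j, 0 < L j 0) -> periodic_shape L S dS ->
  a1 * S (x + w) - a0 * S x =
  (a1 - a0) * \int[mu]_(s in `[0, 1]) S (x + s *: w) +
  \sum_j w j 0 *
    \int[mu]_(s in `[0, 1]) (((1 - s) * a0 + s * a1) * dS j (x + s *: w)).
Proof.
move=> L0 SdS; have [SC1 dSC] := periodic_shape_line x w L0 SdS.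
have aC1 : pw_C1 (fun s : R => (1 - s) * a0 + s * a1) (cst (a1 - a0)).
  apply: C1_pw_C1; last exact: cst_continuous.
  move=> z; rewrite (_ : (fun s => _) = horner (a0%:P + (a1 - a0) *: 'X)).
    apply: (trigger_derive (@is_derive_poly _ _ _)).
    by rewrite derivD derivC derivZ derivX !hornerE.
  by apply/funext => s; rewrite !hornerE; ring.
have SI : mu.-integrable `[0, 1] (EFin \o (fun s => S (x + s *: w))).
  by apply: pw_continuous_integrable => //; apply: continuous_pw_continuous;
    case: SC1.
have dSI j : mu.-integrable `[0, 1]
    (EFin \o (fun s => ((1 - s) * a0 + s * a1) * dS j (x + s *: w))).
  apply: pw_continuous_integrable => //; apply: pw_continuousM => //.
  by apply: continuous_pw_continuous; case: aC1.
have := pw_C1_FTC ler01 (pw_C1M aC1 SC1).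
rewrite /= subrr subr0 !scale1r !scale0r !mul1r !mul0r !addr0 add0r => <-.
rewrite -Rintegral_lin_comb// -RintegralZl// -RintegralD//.
- apply: eq_Rintegral => s _ /=; congr (_ + _).
  by rewrite mulr_sumr; apply: eq_bigr => j _; ring.
- exact: (integrableZl _ (a1 - a0) SI).
- exact: integrable_lin_comb.
Qed.

End Balance.

Theorem lemma4p1 (R : realType) (d : nat) (hd : (1 <= d)%N)
  (dt : R) (hdt : 0 < dt)
  (G : finType) (L : 'cV[R]_d) (hL : forall j, 0 < L j 0)
  (S : G -> 'cV[R]_d -> R) (dS : G -> 'I_d -> 'cV[R]_d -> R)
  (hS : forall g, periodic_shape L (S g) (dS g))
  (A0 A1 U0 U1 : G -> 'cV[R]_d)
  (hA : forall g, A1 g - A0 g = dt *: average (U1 g) (U0 g))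
  (x0 x1 v0 v1 : 'cV[R]_d)
  (hx : x1 - x0 = dt *: average v1 v0) :
  mesh_interp S A1 x1 - mesh_interp S A0 x0 =
    dt *: mean_field S (fun g => average (U1 g) (U0 g)) x0 x1
    + dt *: (mean_gradient dS A0 A1 x0 x1 *m average v1 v0).
Proof.
apply/colP => l; rewrite /mesh_interp /mean_field /mean_gradient.
rewrite scaler_sumr scalemxAr -hx !mxE !summxE -sumrB.
under [X in _ = _ + X]eq_bigr do rewrite mxE mulr_suml.
rewrite exchange_big -big_split /=; apply: eq_bigr => g _.
have := affine_shape_balance x0 (x1 - x0) (A0 g l 0) (A1 g l 0) hL (hS g).
rewrite subrKC => balance.
rewrite scalerA mulrC -scalerA -hA !mxE [S g x1 * _]mulrC [S g x0 * _]mulrC.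
rewrite balance [_ * mean_shape _ _ _ _]mulrC; congr (_ + _).
apply: eq_bigr => j _; rewrite mulrC !mxE; congr (_ * _).
by apply: eq_Rintegral => s _; rewrite !mxE.
Qed.
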